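(* Let $C=(c_1,c_2,\dots,c_r)$ be a sequence of $r$ positive integers and let $P_C=\bigoplus_{i=1}^{r}T_{c_i}=T_{c_1}\oplus\cdots\oplus T_{c_r}$ be the ordinal sum of antichains of $C$. Let $g_{P_C}(q)=\sum_{s=0}^{c_1+\cdots+c_r-1}b_sq^s$ be the cumulative generating function of $P_C$. Then the sequence $(b_s)_{s=0}^{c_1+\cdots+c_r-1}$ is log-concave, i.e. $b_s^2\ge b_{s-1}b_{s+1}$ for all $1\le s\le c_1+\cdots+c_r-2$.
   Context: Let $P$ be a finite poset with $n$ elements. A labeling of $P$ is a bijection $L:P\to\{1,\dots,n\}$. $L$ is natural if $x<_P y$ implies $L(x)<L(y)$. The (extended) promotion $\partial L$ of a labeling $L$ is obtained as follows: (1) repeat until the element labeled $1$ is maximal: let $u$ be the element labeled $1$ and let $v$ be the element with the smallest label among all elements $v>_P u$; swap the labels of $u$ and $v$; (2) then simultaneously replace the label $1$ by $n$ and each label $i>1$ by $i-1$. The order of $L$ is the smallest $k\ge 0$ such that $\partial^k L$ is natural (it is known that the order is always at most $n-1$). The cumulative generating function of an $n$-element poset $P$ is $g_P(q)=\sum_{i=0}^{n-1}b_iq^i$, where $b_i=a_0+a_1+\cdots+a_i$ and $a_i$ is the number of labelings of $P$ of order exactly $i$. $T_k$ denotes the antichain on $k$ elements. The ordinal sum $P\oplus Q$ is the poset on the disjoint union $P\sqcup Q$ in which $s\le t$ iff $s,t\in P$ and $s\le_P t$, or $s,t\in Q$ and $s\le_Q t$, or $s\in P$ and $t\in Q$. 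*)

(* Defs.v *)
From HB Require Import structures.
From mathcomp Require Import all_boot all_order perm all_algebra.

Set Implicit Arguments.
Unset Strict Implicit.
Unset Printing Implicit Defensive.

Import Order.TTheory.

(* Labels are 0-based throughout: [i : 'I_n] stands for the label i + 1. *)
Section Promotion.
Context {d : Order.disp_t} {P : finPOrderType d}.
Implicit Types L : {ffun P -> 'I_#|P|}.

Definition is_labeling L : bool := injectiveb L.

Lemma is_labelingP L : reflect (bijective L) (is_labeling L).
Proof.
apply: (iffP (injectiveP L)) => [injL|/bij_inj //].
by apply: inj_card_bij; rewrite // card_ord.
Qed.

Definition is_natural L : bool :=
  [forall x : P, forall y : P, (x < y)%O ==> (L x < L y)%N].

(* One swap of the smallest label; the identity once its bearer is maximal. *)
Definition slide L : {ffun P -> 'I_#|P|} :=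
  if [pick u : P | L u == 0 :> nat] is Some u then
    if [pick v : P | (u < v)%O &
          [forall w : P, (u < w)%O ==> (L v <= L w)%N]] is Some v
    then [ffun x => L (tperm u v x)]
    else L
  else L.

(* Each effective swap moves the smallest label strictly up in P, so after
   #|P| iterations it sits at a maximal element.  [ord_pred] sends the label 0
   to #|P| - 1 and every other label i to i - 1. *)
Definition promotion L : {ffun P -> 'I_#|P|} :=
  [ffun x => ord_pred (iter #|P| slide L x)].

Definition has_order L (k : nat) : bool :=
  is_natural (iter k promotion L) &&
  [forall j : 'I_k, ~~ is_natural (iter j promotion L)].

End Promotion.

Section GeneratingFunction.
Context {d : Order.disp_t} (P : finPOrderType d).

Definition num_order (i : nat) : nat :=
  #|[set L : {ffun P -> 'I_#|P|} | is_labeling L && has_order L i]|.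

Definition cum_num_order (i : nat) : nat := \sum_(0 <= j < i.+1) num_order j.

Definition cum_gf : {poly nat} := \poly_(i < #|P|) cum_num_order i.

End GeneratingFunction.

Fact ordinal_sum_display : Order.disp_t. Proof. exact: Order.Disp tt tt. Qed.

(* An alias, because 'I_k itself carries its usual total order. *)
Definition antichain (k : nat) : Type := 'I_k.

Section Antichain.
Variable k : nat.

HB.instance Definition _ := Finite.on (antichain k).

Definition antichain_le (x y : antichain k) : bool := x == y.

Fact antichain_le_refl : reflexive antichain_le.
Proof. by move=> x; rewrite /antichain_le. Qed.

Fact antichain_le_anti : antisymmetric antichain_le.
Proof. by move=> x y /andP[/eqP]. Qed.

Fact antichain_le_trans : transitive antichain_le.
Proof. by move=> y x z /eqP-> /eqP->; apply: antichain_le_refl. Qed.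

HB.instance Definition _ := Order.Le_isPOrder.Build ordinal_sum_display
  (antichain k) antichain_le_refl antichain_le_anti antichain_le_trans.

End Antichain.

Definition ordinal_sum {d1 d2 : Order.disp_t}
  (P : finPOrderType d1) (Q : finPOrderType d2) : Type := (P + Q)%type.

Section OrdinalSum.
Context {d1 d2 : Order.disp_t}.
Variables (P : finPOrderType d1) (Q : finPOrderType d2).

HB.instance Definition _ := Finite.on (ordinal_sum P Q).

Definition ordinal_sum_le (s t : ordinal_sum P Q) : bool :=
  match s, t with
  | inl x, inl y => (x <= y)%O
  | inr x, inr y => (x <= y)%O
  | inl _, inr _ => true
  | inr _, inl _ => false
  end.

Fact ordinal_sum_le_refl : reflexive ordinal_sum_le.
Proof. by case=> x /=. Qed.

Fact ordinal_sum_le_anti : antisymmetric ordinal_sum_le.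
Proof. by move=> [x|x] [y|y] //= => [/le_anti->|/le_anti->]. Qed.

Fact ordinal_sum_le_trans : transitive ordinal_sum_le.
Proof. by move=> [y|y] [x|x] [z|z] //=; apply: le_trans. Qed.

HB.instance Definition _ := Order.Le_isPOrder.Build ordinal_sum_display
  (ordinal_sum P Q) ordinal_sum_le_refl ordinal_sum_le_anti
  ordinal_sum_le_trans.

End OrdinalSum.

(* The empty poset [antichain 0] is neutral for the ordinal sum. *)
Fixpoint antichain_sum (C : seq nat) : finPOrderType ordinal_sum_display :=
  if C is c :: C' then ordinal_sum (antichain c) (antichain_sum C')
  else antichain 0.

Lemma card_antichain_sum (C : seq nat) : #|antichain_sum C| = sumn C.
Proof.
elim: C => [|c C IHC]; first exact: card_ord.
by rewrite /= -IHC -[in RHS](card_ord c) -card_sum.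
Qed.

(* Main.v *)
Require Import Defs.
From mathcomp Require Import all_boot all_order perm all_algebra zify.

(** An ordinal sum of antichains is a weak order: incomparability is transitive,
and two incomparable elements have the same elements above them.  List the
elements of a weak order by increasing label.  Promotion acts on this list like
one pass of bubble sort.  The element labeled first is carried to the right; on
meeting an element above it, it is put down and that element is carried
instead; the element carried last ends up at the end.  Call an inversion at x
an element above x that precedes x in the list.  A pass of bubble sort removes
exactly one inversion at every x that has some ([num_inv_promotion]), and a
labeling is natural when it has no inversion.  Hence the labelings of order at
most k are those with at most k inversions at every element
([cum_num_order_bounded]).

To count them, enumerate the poset from top to bottom ([depth]) and encode a
labeling by its Lehmer code, whose entry at x is the number of previously
enumerated elements that precede x in the list.  Those are the inversions at x
together with some of the a(x) peers of x, the elements incomparable to x and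
enumerated before it.  If x has at most k inversions, its code is thus at most
k + a(x).  Conversely, if x is the first enumerated element with more than k
inversions, then every peer of x precedes x in the list, since it has the same
elements above it and at most k of them precede it; so the code at x exceeds
k + a(x).  The labelings of order at most k therefore correspond to the codes
bounded entrywise by min(q(x), k) + a(x), where q(x) is the number of elements
above x ([bounded_num_inv_lehmer]), and the cumulative count is the product
over x of min(q(x), k) + a(x) + 1 ([cum_num_order_weak_order]).

Each factor is positive and concave in k, hence log-concave, and log-concavity
passes to products. *)

Set Implicit Arguments.
Unset Strict Implicit.
Unset Printing Implicit Defensive.

Import Order.TTheory.

(** * Promotion of a weak order as bubble sort *)

Definition weak_order {d : Order.disp_t} (P : finPOrderType d) : Prop :=
  forall x y z : P, (x < y)%O -> (x < z)%O || (z < y)%O.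

Section Inversions.
Context {d : Order.disp_t} {P : finPOrderType d}.
Implicit Types (L : {ffun P -> 'I_#|P|}) (x y u v : P).

Definition inversions L x : {set P} := [set y | (x < y)%O & L y < L x].

Definition num_inv L x : nat := #|inversions L x|.

Lemma is_natural_num_inv L :
  injective L -> is_natural L = [forall x, num_inv L x == 0].
Proof.
move=> injL; apply/forallP/forallP => [natL x|inv0 x].
  rewrite cards_eq0; apply/eqP/setP => y; rewrite !inE.
  apply/negbTE/negP => /andP[xy]; apply/negP; rewrite -leqNgt ltnW //.
  by move/forallP: (natL x) => /(_ y); rewrite xy.
apply/forallP => y; apply/implyP => xy.
have := inv0 x; rewrite cards_eq0 => /eqP/setP/(_ y); rewrite !inE xy /=.
move/negbT; rewrite -leqNgt leq_eqVlt => /orP[/eqP/val_inj/injL eqxy|//].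
by rewrite eqxy ltxx in xy.
Qed.

(** The two outcomes of a slide: the bearer of the smallest label is already
maximal, or it swaps with the element above it of smallest label. *)
Lemma slideP L u : injective L -> L u = 0 :> nat ->
  (slide L = L /\ forall w, ~~ (u < w)%O) \/
  (exists v, [/\ slide L = [ffun x => L (tperm u v x)], (u < v)%O
                & forall w, (u < w)%O -> L v <= L w]).
Proof.
move=> injL Lu0; rewrite /slide; case: pickP => [u' /eqP Lu'|/(_ u)];
  last by rewrite Lu0.
have -> : u' = u by apply/injL/val_inj; rewrite /= Lu0.
case: pickP => [v /andP[uv /forallP minv]|none].
  by right; exists v; split=> // w; apply/implyP.
left; split=> // w; apply/negP => uw.
have [v uv minv] := arg_minnP (fun v => val (L v)) uw.
have := none v; rewrite uv /= => /negP[]; apply/forallP => w'.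
by apply/implyP/minv.
Qed.

Lemma slide_inj L : injective L -> injective (slide L).
Proof.
move=> injL; rewrite /slide; case: pickP => [u _|//]; case: pickP => [v _|//].
by move=> x y; rewrite !ffunE => /injL/perm_inj.
Qed.

Lemma iter_slide_inj k L : injective L -> injective (iter k slide L).
Proof. by move=> injL; elim: k => //= k; apply: slide_inj. Qed.

Lemma promotion_inj L : injective L -> injective (promotion L).
Proof.
move=> injL x y; rewrite !ffunE => /ord_pred_inj.
exact: iter_slide_inj.
Qed.

Lemma labeling_preim0 L x : injective L -> exists u, L u = 0 :> nat.
Proof.
move=> injL; have P_gt0 : 0 < #|P| by apply/card_gt0P; exists x.
have [L' _ LK] : bijective L by apply/is_labelingP/injectiveP.
by exists (L' (Ordinal P_gt0)); rewrite LK.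
Qed.

(** Each effective swap moves the smallest label strictly up, so the number of
elements above its bearer decreases until it vanishes. *)
Lemma iter_slide_maximal L x : injective L ->
  exists2 u, iter #|P| slide L u = 0 :> nat & forall w, ~~ (u < w)%O.
Proof.
move=> injL.
have step k : exists2 u, iter k slide L u = 0 :> nat &
    (forall w, ~~ (u < w)%O) \/ #|[set w | (u < w)%O]| + k <= #|P|.
  elim: k => [|k [u Lu]].
    by have [u Lu] := labeling_preim0 x injL; exists u => //; right;
      rewrite addn0 max_card.
  have := slideP (@iter_slide_inj k L injL) Lu.
  case=> [[/= -> umax] _|[v [/= -> uv _]] hk]; first by exists u => //; left.
  exists v; first by rewrite ffunE tpermR.
  right; case: hk => [/(_ v)|]; first by rewrite uv.
  apply: leq_trans; rewrite addnS -addSn leq_add2r.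
  apply: proper_card; apply/properP; split.
    by apply/subsetP => w; rewrite !inE; apply: lt_trans.
  by exists v; rewrite !inE ?ltxx.
have [u Lu [umax|]] := step #|P|; first by exists u.
rewrite -[X in _ <= X]add0n leq_add2r leqn0 cards_eq0 => /eqP none.
by exists u => // w; have /setP/(_ w) := none; rewrite !inE => ->.
Qed.

Hypothesis weakP : weak_order P.

(** The number of inversions itself is not invariant.  Say u and v swap.  An
element x below v whose label is smaller than that of v acquires v as an
inversion, and loses u if it lies below u.  If it does not, it had no inversion
at all, because an inversion y at x would lie above u with a label smaller than
that of v.  The only change is then from 0 to 1, which the predecessor does not
see. *)
Lemma num_inv_slide L x : injective L ->
  (num_inv (slide L) x).-1 = (num_inv L x).-1.
Proof.
move=> injL; have [u Lu] := labeling_preim0 x injL.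
have [[-> _//]|[v [-> uv minv]]] := slideP injL Lu.
set L' := finfun _.
have L'u : L' u = L v by rewrite ffunE tpermL.
have L'v : L' v = L u by rewrite ffunE tpermR.
have L'E y : y != u -> y != v -> L' y = L y.
  by move=> yu yv; rewrite ffunE tpermD // eq_sym.
have before_v y : L y < L v -> ~~ (u < y)%O.
  by move=> Ly; apply/negP => /minv; rewrite leqNgt Ly.
have le1 (A : {set P}) : A \subset [set v] -> #|A|.-1 = 0.
  by move=> /subset_leq_card; rewrite cards1; case: #|A| => [|[]].
have inv0 y : (forall z, (y < z)%O -> ~~ (L z < L y)) -> num_inv L y = 0.
  move=> none; apply/eqP; rewrite cards_eq0; apply/eqP/setP => z.
  by rewrite !inE; apply/negbTE; rewrite negb_and -implybE; apply/implyP/none.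
have [->{x}|xu] := eqVneq x u.
  rewrite (inv0 u) => [|z _]; last by rewrite Lu.
  apply: le1; apply/subsetP => z; rewrite !inE => /andP[uz].
  apply: contraTT => zv; have zu : z != u by rewrite gt_eqF.
  by rewrite L'u L'E // -leqNgt minv.
have [->{x xu}|xv] := eqVneq x v.
  rewrite (inv0 v) => [|z vz]; last first.
    by apply/negP => /before_v; rewrite (lt_trans uv).
  apply: le1; apply/subsetP => z; rewrite !inE L'v Lu ltn0 andbF //.
have [Lvx|] := ltnP (L v) (L x).
  congr _.-1; apply: eq_card => y; rewrite !inE (L'E x) //; congr (_ && _).
  have [->|yu] := eqVneq y u; first by rewrite L'u Lvx Lu (leq_ltn_trans _ Lvx).
  have [->|yv] := eqVneq y v; last by rewrite L'E.
  by rewrite L'v Lvx Lu (leq_ltn_trans _ Lvx).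
(* When x precedes v, the swap may make v an inversion at x. *)
rewrite leq_eqVlt => /orP[/eqP/val_inj/injL/eqP|Lxv].
  by rewrite (negPf xv).
have [xltu|xNu] := boolP (x < u)%O.
  have xltv := lt_trans xltu uv.
  rewrite /num_inv; suff -> : inversions L' x = tperm u v @^-1: inversions L x.
    congr _.-1; apply: card_preimset; apply: perm_inj.
  apply/setP => y; rewrite !inE (L'E x) // ffunE; congr (_ && _).
  by case: tpermP => // ->; rewrite xltu xltv.
have inv_x y : (x < y)%O -> ~~ (L y < L x).
  move=> xy; apply/negP => Lyx; have := weakP u xy.
  by rewrite (negPf xNu) (negPf (before_v _ (ltn_trans Lyx Lxv))).
rewrite (inv0 x) //; apply: le1; apply/subsetP => y.
rewrite !inE (L'E x) // => /andP[xy].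
apply: contraTT => yv; rewrite L'E ?inv_x //.
by apply: contraNneq xNu => <-.
Qed.

(** Sliding leaves the smallest label on a maximal element u, and relabeling
then sends u from the first place to the last.  This removes u from the
inversions at every x below u; any other x is maximal by weak order, hence has
no inversion. *)
Lemma num_inv_promotion L x : injective L ->
  num_inv (promotion L) x = (num_inv L x).-1.
Proof.
move=> injL; set M := iter #|P| slide L.
have -> : (num_inv L x).-1 = (num_inv M x).-1.
  suff slides k : (num_inv (iter k slide L) x).-1 = (num_inv L x).-1.
    by rewrite slides.
  elim: k => //= k <-; apply: num_inv_slide; exact: iter_slide_inj.
have injM : injective M by apply: iter_slide_inj.
have [u Mu umax] := iter_slide_maximal x injL; rewrite -/M in Mu.
have P_gt0 : 0 < #|P| by apply/card_gt0P; exists x.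
have M'u : promotion L u = #|P|.-1 :> nat.
  by rewrite ffunE /= Mu add0n modn_small // prednK.
have M_gt0 y : y != u -> 0 < M y.
  by move=> yu; rewrite lt0n -Mu (inj_eq val_inj) (inj_eq injM).
have M'E y : y != u -> promotion L y = (M y).-1 :> nat.
  move=> /M_gt0; rewrite ffunE /= -/M.
  case: (nat_of_ord (M y)) (ltn_ord (M y)) => //= i i_lt _.
  by rewrite modnDr modn_small // ltnW.
have inv_u K : num_inv K u = 0.
  by apply: eq_card0 => y; rewrite !inE (negPf (umax y)).
have [->|xu] := eqVneq x u; first by rewrite !inv_u.
have -> : num_inv (promotion L) x = #|inversions M x :\ u|.
  apply: eq_card => y; rewrite !inE (M'E x) //; have [->|yu] := eqVneq y u.
    rewrite M'u ltnNge; suff -> : (M x).-1 <= #|P|.-1 by rewrite andbF.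
    by rewrite -!subn1 leq_sub2r // ltnW.
  rewrite M'E //; move: (M_gt0 x xu) (M_gt0 y yu).
  by case: (nat_of_ord (M x)) (nat_of_ord (M y)) => [//|i] [].
rewrite /num_inv (cardsD1 u (inversions M x)).
have [_|] := boolP (u \in _) => //.
rewrite inE Mu M_gt0 // andbT add0n => xNu.
suff -> : inversions M x :\ u = set0 by rewrite cards0.
apply/setP => y; rewrite !inE; apply/negbTE; rewrite !negb_and.
apply/orP; right.
have [xy|//] := boolP (x < y)%O; have := weakP u xy.
by rewrite (negPf xNu) (negPf (umax y)).
Qed.

Lemma is_natural_iter_promotion k L : injective L ->
  is_natural (iter k promotion L) = [forall x, num_inv L x <= k].
Proof.
move=> injL; have inj_k j : injective (iter j promotion L).
  by elim: j => //= j; apply: promotion_inj.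
rewrite is_natural_num_inv //; apply: eq_forallb => x.
rewrite -subn_eq0; congr (_ == 0); elim: k => [|k IHk]; first by rewrite subn0.
by rewrite subnS -IHk; apply: num_inv_promotion; apply: inj_k.
Qed.

Definition bounded_labelings k : {set {ffun P -> 'I_#|P|}} :=
  [set L | is_labeling L & [forall x, num_inv L x <= k]].

Lemma cum_num_order_bounded k :
  cum_num_order P k = #|bounded_labelings k|.
Proof.
rewrite /cum_num_order; elim: k => [|k IHk].
  rewrite big_nat1; apply: eq_card => L; rewrite !inE.
  have [/injectiveP injL|//] := boolP (is_labeling L).
  rewrite /has_order (is_natural_iter_promotion 0) //=.
  by rewrite [X in _ && X](_ : _ = true) ?andbT //; apply/forallP => -[].
rewrite big_nat_recr //= IHk.
rewrite -(cardsID (bounded_labelings k) (bounded_labelings k.+1)).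
congr (_ + _); apply: eq_card => L; rewrite !inE.
  have [_|//] := boolP (is_labeling L); rewrite /=.
  apply/idP/andP => [le_k|[]//]; split=> //; apply/forallP => x.
  by rewrite leqW // (forallP le_k).
have [/injectiveP injL|//] := boolP (is_labeling L) => /=.
rewrite /has_order is_natural_iter_promotion // andbC; congr (_ && _).
apply/forallP/idP => [/(_ ord_max)|Ngtk j].
  by rewrite is_natural_iter_promotion.
rewrite is_natural_iter_promotion //; apply: contra Ngtk => /forallP le_j.
by apply/forallP => x; rewrite (leq_trans (le_j x)) // -ltnS.
Qed.

End Inversions.

(** * Lehmer codes of labelings *)

Section Rank.
Variables (T : finType) (g : T -> nat).
Hypothesis g_inj : injective g.

Definition rank x : nat := #|[set y | g y < g x]|.

Lemma rank_lt x y : (rank x < rank y) = (g x < g y).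
Proof.
have homo a b : g a < g b -> rank a < rank b.
  move=> ab; apply: proper_card; apply/properP; split.
    by apply/subsetP => z; rewrite !inE => za; apply: ltn_trans ab.
  by exists a; rewrite !inE ?ltnn.
apply/idP/idP; last exact: homo.
rewrite !ltnNge; apply: contra.
by rewrite leq_eqVlt => /orP[/eqP/g_inj->|/homo/ltnW].
Qed.

Lemma rank_inj : injective rank.
Proof.
move=> x y eqxy; apply: g_inj; case: (ltngtP (g x) (g y)) => //.
  by rewrite -rank_lt eqxy ltnn.
by rewrite -rank_lt eqxy ltnn.
Qed.

Lemma rank_ltn x : rank x < #|T|.
Proof.
rewrite -cardsT; apply: proper_card; apply/properP; split.
  exact: subsetT.
by exists x; rewrite !inE ?ltnn.
Qed.

Lemma prod_rank : \prod_x (rank x).+1 = #|T|`!.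
Proof.
pose r x := Ordinal (rank_ltn x).
have r_inj : injective r by move=> x y [/rank_inj].
rewrite fact_prod big_add1 big_mkord /=.
rewrite (reindex r) //=; apply: onW_bij.
by apply: inj_card_bij; rewrite ?card_ord.
Qed.

Lemma card_ord_lt n k : k <= n -> #|[set i : 'I_n | i < k]| = k.
Proof.
move=> k_le; rewrite -sum1_card (eq_bigl (fun i : 'I_n => i < k)) => [|i].
  by rewrite (big_ord_narrow k_le) sum1_card card_ord.
by rewrite inE.
Qed.

Lemma card_bounded_ffun n (m : T -> nat) : (forall x, m x < n) ->
  #|[set c : {ffun T -> 'I_n} | [forall x, c x <= m x]]| = \prod_x (m x).+1.
Proof.
move=> m_lt; rewrite cardsE.
have -> : \prod_x (m x).+1 = \prod_x #|[pred i : 'I_n | i <= m x]|.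
  apply: eq_bigr => x _; rewrite -[LHS](card_ord_lt (m_lt x)).
  by apply: eq_card => i; rewrite !inE.
rewrite -(big_image _ _ (fun x => #|[pred i : 'I_n | i <= m x]|) predT id).
rewrite -foldrE.
by rewrite -card_family; apply: eq_card => c; rewrite !inE.
Qed.

Lemma card_injections :
  #|[set L : {ffun T -> 'I_#|T|} | injectiveb L]| = #|T|`!.
Proof. by rewrite card_inj_ffuns card_ord ffactnn. Qed.

Implicit Types L M : {ffun T -> 'I_#|T|}.

Definition earlier_below L x : {set T} := [set y | g y < g x & L y < L x].

Lemma earlier_below_le L x : #|earlier_below L x| <= rank x.
Proof. by apply/subset_leq_card/subsetP => y; rewrite !inE => /andP[]. Qed.

Definition lehmer L : {ffun T -> 'I_#|T|} :=
  [ffun x => Ordinal (leq_ltn_trans (earlier_below_le L x) (rank_ltn x))].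

Lemma lehmerE L x : lehmer L x = #|earlier_below L x| :> nat.
Proof. by rewrite ffunE. Qed.

Lemma labeling_rank L x : injective L -> #|[set y | L y < L x]| = L x.
Proof.
move=> injL; rewrite -[RHS](card_ord_lt (ltnW (ltn_ord (L x)))).
rewrite -(on_card_preimset (f := L)).
  by apply: eq_card => y; rewrite !inE.
by apply: onW_bij; apply: inj_card_bij; rewrite ?card_ord.
Qed.

(** Enumerate T by increasing g.  Once the relative order of the elements
enumerated before x is known, those preceding x form an initial segment of it,
and the code gives the size of this segment; so the position of x among them is
known as well. *)
Lemma lehmer_inj :
  {in [set L : {ffun T -> 'I_#|T|} | injectiveb L] &, injective lehmer}.
Proof.
move=> L M; rewrite !inE => /injectiveP injL /injectiveP injM eqLM.
have flip (K : {ffun T -> 'I_#|T|}) a b :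
    injective K -> a != b -> (K a < K b) = ~~ (K b < K a).
  move=> injK ab; rewrite -leqNgt [RHS]leq_eqVlt.
  by rewrite (inj_eq (@ord_inj _)) (inj_eq injK) (negPf ab).
have agree m x y : g x < m -> g y < g x -> (L y < L x) = (M y < M x).
  elim: m x y => // m IHm x y; rewrite ltnS => x_le yx.
  have agree_before a b :
      g a < g x -> g b < g x -> (L a < L b) = (M a < M b).
    move=> ax bx.
    case: (ltngtP (g a) (g b)) => [ab|ba|/g_inj->]; last by rewrite !ltnn.
      by apply: IHm ab; apply: leq_trans x_le.
    have neq_ab : a != b by apply: contraTneq ba => ->; rewrite ltnn.
    rewrite !(flip _ a b) //; congr (~~ _).
    by apply: IHm ba; apply: leq_trans x_le.
  have neqx z : g z < g x -> z != x.
    by move=> zx; apply: contraTneq zx => ->; rewrite ltnn.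
  suff /setP/(_ y) : earlier_below L x = earlier_below M x by rewrite !inE yx.
  have eq_card_code : #|earlier_below L x| = #|earlier_below M x|.
    by rewrite -!lehmerE eqLM.
  (* Of two initial segments of one total order, one contains the other. *)
  have [sLM|] := boolP (earlier_below L x \subset earlier_below M x).
    by apply/eqP; rewrite eqEcard sLM eq_card_code leqnn.
  case/subsetPn => a; rewrite !inE => /andP[ax Lax]; rewrite ax /= => MNax.
  have Mxa : M x < M a by rewrite flip // eq_sym neqx.
  apply/esym/eqP; rewrite eqEcard eq_card_code leqnn andbT.
  apply/subsetP => b; rewrite !inE => /andP[bx Mbx]; rewrite bx /=.
  by apply: ltn_trans Lax; rewrite agree_before // (ltn_trans Mbx).
apply/ffunP => x; apply: val_inj.
rewrite /= -(labeling_rank x injL) -(labeling_rank x injM).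
apply: eq_card => y; rewrite !inE.
case: (ltngtP (g y) (g x)) => [yx|xy|/g_inj->]; last by rewrite !ltnn.
  exact: (agree (g x).+1).
have neq_yx : y != x by apply: contraTneq xy => ->; rewrite ltnn.
by rewrite !(flip _ y x) //; congr (~~ _); apply: (agree (g y).+1).
Qed.

(** There are as many labelings as sequences c with c x <= rank x, so the
injective map [lehmer] is onto these sequences. *)
Lemma card_bounded_lehmer (m : T -> nat) : (forall x, m x <= rank x) ->
  #|[set L : {ffun T -> 'I_#|T|} | injectiveb L &
       [forall x, lehmer L x <= m x]]| = \prod_x (m x).+1.
Proof.
move=> m_le; pose I := [set L : {ffun T -> 'I_#|T|} | injectiveb L].
pose F k := [set c : {ffun T -> 'I_#|T|} | [forall x, c x <= k x]].
have FE : lehmer @: I = F rank.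
  apply/eqP; rewrite eqEcard (card_in_imset lehmer_inj).
  rewrite card_bounded_ffun; last exact: rank_ltn.
  rewrite prod_rank card_injections leqnn andbT.
  apply/subsetP => c /imsetP[L _ ->]; rewrite inE; apply/forallP => x.
  by rewrite lehmerE earlier_below_le.
rewrite -(@card_bounded_ffun #|T|) => [|x]; last first.
  exact: leq_ltn_trans (rank_ltn x).
rewrite -(card_in_imset (f := lehmer)) => [|L M]; last first.
  rewrite !inE => /andP[injL _] /andP[injM _].
  by apply: lehmer_inj; rewrite inE.
apply: eq_card => c; apply/imsetP/idP => [[L]|]; rewrite !inE.
  by case/andP=> _ le_m ->.
move=> le_m; have : c \in lehmer @: I.
  rewrite FE inE; apply/forallP => x.
  exact: leq_trans (forallP le_m x) (m_le x).
by case/imsetP => L; rewrite inE => injL cE; exists L; rewrite // inE injL -cE.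
Qed.
End Rank.

(** * The cumulative count of a weak order *)

Section Count.
Context {d : Order.disp_t} {P : finPOrderType d}.
Hypothesis weakP : weak_order P.
Implicit Types (L : {ffun P -> 'I_#|P|}) (x y : P).

Definition up x : {set P} := [set y | (x < y)%O].

(** An injective order-reversing map: the number of elements above x decides
first, and an arbitrary enumeration breaks ties. *)
Definition depth x : nat := #|up x| * #|P| + enum_rank x.

Lemma depth_inj : injective depth.
Proof.
move=> x y /(congr1 (modn^~ #|P|)).
by rewrite !modnMDl !modn_small // => /val_inj/enum_rank_inj.
Qed.

Lemma depth_lt x y : (x < y)%O -> depth y < depth x.
Proof.
move=> xy; have : #|up y| < #|up x|.
  apply: proper_card; apply/properP; split.
    by apply/subsetP => z; rewrite !inE; apply: lt_trans.
  by exists y; rewrite !inE ?ltxx.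
rewrite /depth => up_lt; apply: (@leq_trans (#|up y|.+1 * #|P|)).
  by rewrite mulSn addnC ltn_add2r.
by apply: leq_trans (leq_addr _ _); rewrite leq_mul2r up_lt orbT.
Qed.

Definition peers_before x : {set P} :=
  [set y | depth y < depth x & ~~ (x < y)%O].

Lemma rank_depth x : rank depth x = #|up x| + #|peers_before x|.
Proof.
rewrite /rank -(cardsID (up x)).
congr (_ + _); apply: eq_card => y; rewrite !inE.
  by apply: andb_idl => /depth_lt.
by rewrite andbC.
Qed.

Lemma lehmer_depth L x :
  lehmer depth L x =
    num_inv L x + #|peers_before x :&: [set y | L y < L x]| :> nat.
Proof.
rewrite lehmerE -(cardsID (up x)).
congr (_ + _); apply: eq_card => y; rewrite !inE.
  by rewrite andbAC; congr (_ && _); apply: andb_idl => /depth_lt.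
by rewrite andbCA andbA.
Qed.

(** This fails in a general poset, where incomparable elements may have
different elements above them. *)
Lemma peers_up x y : y \in peers_before x -> up y = up x.
Proof.
rewrite inE => /andP[yx xNy]; apply/setP => z; rewrite !inE.
have yNx : ~~ (y < x)%O.
  by apply: contraTN yx => /depth_lt; rewrite -leqNgt => /ltnW.
apply/idP/idP => [yz|xz].
  by have := weakP x yz; rewrite (negPf yNx).
by have := weakP y xz; rewrite (negPf xNy).
Qed.

(** The bound on the code at a single x does not bound the inversions at x;
the induction on depth uses the bounds at the peers enumerated before x. *)
Lemma bounded_num_inv_lehmer k L : injective L ->
  [forall x, num_inv L x <= k] =
  [forall x, lehmer depth L x <= minn #|up x| k + #|peers_before x|].
Proof.
move=> injL; apply/forallP/forallP => [inv_le x|code_le x].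
  rewrite lehmer_depth leq_add //; last exact/subset_leq_card/subsetIl.
  rewrite leq_min inv_le andbT; apply/subset_leq_card/subsetP => y.
  by rewrite !inE => /andP[].
have [m] := ubnP (depth x); elim: m x => // m IHm x; rewrite ltnS => x_le.
rewrite leqNgt; apply/negP => inv_gt; have := code_le x.
(* All peers enumerated before x precede x, so the code is too large. *)
rewrite lehmer_depth (setIidPl _) => [|].
  by rewrite leq_add2r leq_min [_ <= k]leqNgt inv_gt andbF.
apply/subsetP => y y_peer; rewrite inE ltnNge; apply/negP => Lxy.
have yx : depth y < depth x by move: y_peer; rewrite inE => /andP[].
have := IHm y (leq_trans yx x_le); rewrite leqNgt => /negP[].
apply: leq_trans inv_gt _; apply/subset_leq_card/subsetP => z.
have /setP/(_ z) := peers_up y_peer; rewrite !inE => -> /andP[->].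
by move=> /leq_trans->.
Qed.

Lemma cum_num_order_weak_order k :
  cum_num_order P k = \prod_(x : P) (minn #|up x| k + #|peers_before x|).+1.
Proof.
rewrite cum_num_order_bounded // -(@card_bounded_lehmer _ depth).
- apply: eq_card => L; rewrite !inE.
  have [/injectiveP injL|] := boolP (is_labeling L).
    by rewrite (bounded_num_inv_lehmer k injL) (introT (injectiveP L) injL).
  by rewrite /is_labeling => /negPf->.
- exact: depth_inj.
by move=> x; rewrite rank_depth leq_add2r geq_minl.
Qed.

Lemma truncation_log_concave q a s :
  (minn q s + a).+1 * (minn q s.+2 + a).+1 <= (minn q s.+1 + a).+1 ^ 2.
Proof.
(* The middle factor is at least the mean of the outer ones, by concavity. *)
rewrite -(leq_pmul2l (isT : 0 < 4)); apply: leq_trans (nat_AGM2 _ _) _.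
by rewrite -[4]/(2 ^ 2) -expnMn leq_exp2r; lia.
Qed.

Lemma cum_num_order_log_concave s :
  cum_num_order P s * cum_num_order P s.+2 <= cum_num_order P s.+1 ^ 2.
Proof.
rewrite !cum_num_order_weak_order -mulnn -!big_split /=.
by apply: leq_prod => x _; rewrite mulnn truncation_log_concave.
Qed.

End Count.

(** * Ordinal sums of antichains *)

Lemma weak_order_antichain_sum C : weak_order (antichain_sum C).
Proof.
elim: C => [[]//|c C IHC] x y z.
case: x y z => [x|x] [y|y] [z|z] //.
- by rewrite lt_neqAle => /andP[] /eqP ? /eqP ?; congruence.
- by move=> _; apply/orP; right.
have lt_inr (a b : antichain_sum C) :
    ((inr a : ordinal_sum (antichain c) (antichain_sum C)) < inr b)%O =
    (a < b)%O.
  by rewrite !lt_neqAle.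
by rewrite !lt_inr; apply: IHC.
Qed.

Theorem proposition6p3 (C : seq nat)
  (C_pos : forall c : nat, c \in C -> 0 < c) (s : nat)
  (s_bounds : 1 <= s <= sumn C - 2) :
  let b := fun i : nat => ((cum_gf (antichain_sum C))`_i)%R in
  b (s - 1) * b (s + 1) <= b s ^ 2.
Proof.
case: s s_bounds => // s /andP[_ s_lt].
have bE i : i <= s.+2 ->
    ((cum_gf (antichain_sum C))`_i)%R = cum_num_order (antichain_sum C) i.
  move=> i_le; rewrite coef_poly card_antichain_sum.
  by rewrite (leq_ltn_trans i_le) //; lia.
rewrite /= subn1 addn1 /= !bE //; last by rewrite ltnW.
exact/cum_num_order_log_concave/weak_order_antichain_sum.
Qed.
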